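(* Let $k,\ell\in\mathbb Z_{\ge1}$. The following identities of differential operators on $C^\infty(\mathbb R^3)$ hold (products denote composition): (1) if $k<\ell$: $\mathcal D_+^{(k,\ell)}=\mathcal D_2^{\ell}\mathcal D_1^{k}$, $\mathcal D_-^{(\ell-k,\ell)}=\mathcal D_1^{\ell-k}\mathcal D_2^{\ell}$, and $\mathcal D_c^{(2k-\ell;\ell)}=\mathcal D_1^{\ell-k}\mathcal D_+^{(k,\ell)}=\mathcal D_-^{(\ell-k,\ell)}\mathcal D_1^{k}=\mathcal D_1^{\ell-k}\mathcal D_2^{\ell}\mathcal D_1^{k}$; (2) if $k>\ell$: $\mathcal D_1^{k-\ell}\mathcal D_c^{(2k-\ell;\ell)}=\mathcal D_+^{(k,\ell)}=\mathcal D_2^{\ell}\mathcal D_1^{k}$; (3) if $k>\ell$: $\mathcal D_+^{(k,k-\ell)}=\mathcal D_2^{k-\ell}\mathcal D_1^{k}$, $\mathcal D_-^{(k,\ell)}=\mathcal D_1^{k}\mathcal D_2^{\ell}$, and $\mathcal D_c^{(k-2\ell;k)}=\mathcal D_+^{(k,k-\ell)}\mathcal D_2^{\ell}=\mathcal D_2^{k-\ell}\mathcal D_-^{(k,\ell)}=\mathcal D_2^{k-\ell}\mathcal D_1^{k}\mathcal D_2^{\ell}$; (4) if $k<\ell$: $\mathcal D_2^{\ell-k}\mathcal D_c^{(k-2\ell;k)}=\mathcal D_-^{(k,\ell)}=\mathcal D_1^{k}\mathcal D_2^{\ell}$; (5) $\mathcal D_c^{(k;k)}=\mathcal D_+^{(k,k)}=\mathcal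 D_2^{k}\mathcal D_1^{k}$; (6) $\mathcal D_c^{(-k;k)}=\mathcal D_-^{(k,k)}=\mathcal D_1^{k}\mathcal D_2^{k}$. (In each case these are factorizations of the $SL(3,\mathbb R)$-intertwining differential operators between principal series representations realized on the open Bruhat cell via $(x_1,x_2,x_3)\mapsto\exp(x_1E_{2,1}+x_2E_{3,2}+x_3E_{3,1})$.)
   Context: On $\mathbb R^3$ with coordinates $(x_1,x_2,x_3)$: $\mathcal D_1=\partial_{x_1}+\frac{x_2}2\partial_{x_3}$, $\mathcal D_2=\partial_{x_2}-\frac{x_1}2\partial_{x_3}$, $\mathcal D_3=\partial_{x_3}$ (these are the infinitesimal right translations by $E_{2,1},E_{3,2},E_{3,1}$ in exponential coordinates of the lower unitriangular group). Symmetrization $\mathbf s(\mathcal D_1^p\mathcal D_2^q\mathcal D_3^r)$ = average over all orderings of the product containing $\mathcal D_1$ $p$ times, $\mathcal D_2$ $q$ times, $\mathcal D_3$ $r$ times. Cayley continuants: $\mathrm{Cay}_m(x;y)=\sum_{j=0}^m\binom mj(\frac{x+y}2)^{\underline j}(\frac{x-y}2)^{\overline{m-j}}$, with $r^{\underline j}=r(r-1)\cdots(r-j+1)$ and $r^{\overline j}=r(r+1)\cdots(r+j-1)$ (equivalently the $m\times m$ tridiagonal determinant with diagonal $x$, superdiagonal $1,\dots,m-1$, subdiagonal $y,\dots,y-m+2$). For $a,b\in\mathbb Z_{\ge0}$, $s\in\mathbb C$: $\mathcal D_\pm^{(a,b)}=\sum_{m=0}^{\min(a,b)}\frac{(\pm1)^m}{2^m}m!\binom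 am\binom bm\mathbf s(\mathcal D_1^{a-m}\mathcal D_2^{b-m}\mathcal D_3^m)$ and $\mathcal D_c^{(s;a)}=\sum_{m=0}^a\frac1{2^m}\binom am\mathrm{Cay}_m(s;a)\mathbf s(\mathcal D_1^{a-m}\mathcal D_2^{a-m}\mathcal D_3^m)$. *)

(* Defs.v *)
From HB Require Import structures.
From mathcomp Require Import all_boot all_order all_algebra.
From mathcomp Require Import all_classical all_reals all_analysis.
Set Implicit Arguments. Unset Strict Implicit. Unset Printing Implicit Defensive.
Import Order.TTheory GRing.Theory Num.Theory.
Import numFieldNormedType.Exports.
Local Open Scope ring_scope.

Section Ops.
Variables (R : realType) (W : normedModType R).

(* Points of R^3 are row vectors; coordinates x_1,x_2,x_3 are x 0 0, x 0 1, x 0 2. *)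
Definition pt := 'rV[R]_3.
Definition coord (x : pt) (i : 'I_3) : R := x ord0 i.
Definition evec (i : 'I_3) : pt := delta_mx ord0 i.

Definition partial (i : 'I_3) (f : pt -> W) : pt -> W :=
  fun x => derive f x (evec i).

Definition iter_partial (w : seq 'I_3) (f : pt -> W) : pt -> W :=
  foldr partial f w.

Definition smooth (f : pt -> W) : Prop :=
  forall (w : seq 'I_3) (x : pt), differentiable (iter_partial w f) x.

Definition i0 : 'I_3 := @Ordinal 3 0 isT.
Definition i1 : 'I_3 := @Ordinal 3 1 isT.
Definition i2 : 'I_3 := @Ordinal 3 2 isT.

Definition D1 (f : pt -> W) : pt -> W :=
  fun x => partial i0 f x + (coord x i1 / 2) *: partial i2 f x.
Definition D2 (f : pt -> W) : pt -> W :=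
  fun x => partial i1 f x - (coord x i0 / 2) *: partial i2 f x.
Definition D3 (f : pt -> W) : pt -> W := partial i2 f.

Definition Dop (i : 'I_3) : (pt -> W) -> (pt -> W) :=
  if val i == 0%N then D1 else if val i == 1%N then D2 else D3.

Definition word_op (w : seq 'I_3) (f : pt -> W) : pt -> W := foldr Dop f w.

(* Orderings of the multiset {D1^p, D2^q, D3^r}: words of length p+q+r
   with p letters 0, q letters 1 (hence r letters 2). *)
Definition orderings (p q r : nat) : pred ((p + q + r).-tuple 'I_3) := 
  fun w => (count_mem i0 w == p) && (count_mem i1 w == q).
Arguments orderings : clear implicits.

Definition sym (p q r : nat) (f : pt -> W) : pt -> W :=
  fun x => (#|orderings p q r|%:R)^-1 *:
           \sum_(w in orderings p q r) word_op w f x.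

Definition opow (D : (pt -> W) -> (pt -> W)) (n : nat) f := iter n D f.

Definition Dpm (sign : bool) (a b : nat) (f : pt -> W) : pt -> W :=
  fun x => \sum_(m < (minn a b).+1)
     ((if sign then 1 else -1) ^+ m / 2 ^+ m * (m`!)%:R
        * ('C(a, m))%:R * ('C(b, m))%:R) *: sym (a - m) (b - m) m f x.

End Ops.

Definition falling {R : ringType} (r : R) (j : nat) : R :=
  \prod_(i < j) (r - i%:R).
Definition rising {R : ringType} (r : R) (j : nat) : R :=
  \prod_(i < j) (r + i%:R).

Definition Cay {R : fieldType} (m : nat) (x y : R) : R :=
  \sum_(j < m.+1) ('C(m, j))%:R * falling ((x + y) / 2) j
                   * rising ((x - y) / 2) (m - j).

(* D_c^{(s;a)} (s real; in the theorem s is always an integer) *)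
Definition Dc {R : realType} {W : normedModType R} (s : R) (a : nat)
  (f : pt R -> W) : pt R -> W :=
  fun x => \sum_(m < a.+1)
     ((2 ^+ m)^-1 * ('C(a, m))%:R * Cay m s a%:R) *: sym (a - m) (a - m) m f x.

(* Main.v *)
From Pilot Require Import Defs.
From HB Require Import structures.
From mathcomp Require Import all_boot all_order all_algebra.
From mathcomp Require Import all_classical all_reals all_analysis.
From mathcomp Require Import ring lra zify.
Import Order.TTheory GRing.Theory Num.Theory.
Import numFieldNormedType.Exports.
Local Open Scope ring_scope.

(* With X, Y, Z = D_1, D_2, D_3 one has Y X = X Y + Z, Z central, and the
   symmetrized products s(p,q,r) of X^p, Y^q, Z^r satisfy
     (p+q+r) s(p,q,r) = p X s(p-1,q,r) + q Y s(p,q-1,r) + r Z s(p,q,r-1),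
   whence by induction on p+q+r
     X s(p,q,r) = s(p+1,q,r) - (q/2) s(p,q-1,r+1),
     Y s(p,q,r) = s(p,q+1,r) + (p/2) s(p-1,q,r+1).
   Put T(p,q;c) = sum_m 2^-m binom(q,m) c_m s(p-m,q-m,m), where c has the
   exponential generating function (1+t)^u (1-t)^(-v).  Applying X multiplies
   this function by 1-t and raises p by one; applying Y to the sum with p and q
   exchanged multiplies it by 1+t.  All of D_+, D_-, D_c are such sums, with
   (u,v) = (k,0), (0,-k), ((s+a)/2,(s-a)/2), so each factorization is read off
   from the parameters.  The commutation relations rest on the symmetry of
   second derivatives, which for values in a normed space follows from the mean
   value inequality. *)

(** * Cayley continuants *)

Section FallingRising.
Context {R : numFieldType}.
Implicit Types u v : R.

Lemma fallingS u n : falling u n.+1 = falling u n * (u - n%:R).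
Proof. by rewrite /falling big_ord_recr. Qed.

Lemma risingS u n : rising u n.+1 = rising u n * (u + n%:R).
Proof. by rewrite /rising big_ord_recr. Qed.

Lemma falling_opp u n : falling (- u) n = (-1) ^+ n * rising u n.
Proof.
elim: n => [|n IH]; first by rewrite /falling /rising !big_ord0 expr0 mul1r.
by rewrite fallingS risingS IH exprS; ring.
Qed.

Lemma rising_opp u n : rising (- u) n = (-1) ^+ n * falling u n.
Proof.
by rewrite -{2}(opprK u) falling_opp mulrA -expr2 -exprM mulnC exprM sqrrN !expr1n mul1r.
Qed.

Lemma falling_nat k n : falling (k%:R : R) n = (n`! * 'C(k, n))%:R.
Proof.
elim: n => [|n IH]; first by rewrite /falling big_ord0 bin0.
rewrite fallingS IH; have [nk|kn] := leqP n k; last first.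
  by rewrite (bin_small kn) (bin_small (leqW kn)) !muln0 mul0r.
rewrite -natrB // -natrM; congr _%:R.
by rewrite factS (mulnC n.+1) -!mulnA mul_bin_left (mulnC (k - n)%N).
Qed.

Lemma falling_small k n : (k < n)%N -> falling (k%:R : R) n = 0.
Proof. by move=> kn; rewrite falling_nat bin_small // muln0. Qed.

Lemma rising0 n : (0 < n)%N -> rising (0 : R) n = 0.
Proof. by case: n => // n _; rewrite /rising big_ord_recl addr0 mul0r. Qed.

Lemma rising_pred v n : rising (v - 1) n = rising v n - n%:R * rising v n.-1.
Proof.
elim: n => [|n IH]; first by rewrite /rising !big_ord0 mul0r subr0.
rewrite risingS IH /=; case: n {IH} => [|n] /=.
  by rewrite /rising !big_ord0 big_ord1 /=; ring.
by rewrite !risingS -!natr1; ring.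
Qed.

(* With [u = (x + y) / 2] and [v = (x - y) / 2] this is [Cay n x y]; its
   exponential generating function in [t] is [(1 + t)^u (1 - t)^(- v)]. *)
Definition cay n u v : R :=
  \sum_(j < n.+1) 'C(n, j)%:R * falling u j * rising v (n - j).

(** Lowering [v] by one multiplies the generating function by [1 - t]. Termwise this is
    [rising_pred] combined with [(n+1) C(n,j) = (n+1-j) C(n+1,j)]. *)
Lemma cay_pred n u v : cay n u (v - 1) = cay n u v - n%:R * cay n.-1 u v.
Proof.
case: n => [|n]; first by rewrite /cay !big_ord1 /= mul0r subr0 /rising !big_ord0.
rewrite /cay big_ord_recr [X in _ = X - _]big_ord_recr /= !subnn.
rewrite [rising (v - 1) 0]/rising [rising v 0]/rising !big_ord0.
rewrite -[RHS]addrAC; congr (_ + _).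
rewrite mulr_sumr -sumrB; apply: eq_bigr => j _; have jn := ltn_ord j.
rewrite rising_pred subSn //= mulrBr; congr (_ - _).
have -> : n.+1%:R * ('C(n, j)%:R * falling u j * rising v (n - j))
   = (n.+1 * 'C(n, j))%:R * (falling u j * rising v (n - j)) by rewrite natrM; ring.
have -> : (n.+1 * 'C(n, j))%N = ('C(n.+1, j) * (n - j).+1)%N.
  by rewrite mul_bin_down mulnC subSn // -ltnS.
by rewrite natrM; ring.
Qed.

(** Substituting [-t] for [t] turns [(1+t)^u (1-t)^(-v)] into [(1+t)^(-v) (1-t)^u], whose parameters
    are [-v] and [-u]. *)
Lemma cay_opp n u v : cay n (- v) (- u) = (-1) ^+ n * cay n u v.
Proof.
rewrite /cay (reindex_inj rev_ord_inj) /= mulr_sumr; apply: eq_bigr => j _.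
have jn : (j <= n)%N by rewrite -ltnS.
rewrite subSS bin_sub // subKn // falling_opp rising_opp.
have -> : (-1) ^+ n = (-1) ^+ (n - j) * (-1) ^+ j :> R by rewrite -exprD subnK.
by ring.
Qed.

(** The conjugate of [cay_pred] under [t -> -t]: the factor becomes [1 + t]. *)
Lemma cay_succ n u v : cay n (u + 1) v = cay n u v + n%:R * cay n.-1 u v.
Proof.
have sg m (x : R) : (-1) ^+ m * ((-1) ^+ m * x) = x.
  by rewrite mulrA -expr2 -exprM mulnC exprM sqrrN !expr1n mul1r.
rewrite -[LHS](sg n) -cay_opp opprD cay_pred !cay_opp mulrBr sg.
case: n => [|n] /=; first by ring.
by rewrite exprS -[in RHS](sg n (cay n u v)); ring.
Qed.

(** Here the generating function is the polynomial [(1+t)^k (1-t)^d], of degree [k + d]. *)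
Lemma cay_small n k d : (k + d < n)%N -> cay n k%:R (- d%:R) = 0.
Proof.
move=> kdn; rewrite /cay big1 // => j _; have [jk|kj] := leqP j k.
  by rewrite rising_opp (falling_small d) ?mulr0 //; lia.
by rewrite falling_small // mulr0 mul0r.
Qed.

Lemma cay_v0 n u : cay n u 0 = falling u n.
Proof.
rewrite /cay big_ord_recr /= big1 => [|j _]; last first.
  by rewrite rising0 ?mulr0 // subn_gt0.
by rewrite binn subnn /rising big_ord0; ring.
Qed.

Lemma cay_0v n v : cay n 0 v = rising v n.
Proof.
by rewrite -[v]opprK -[0]oppr0 cay_opp cay_v0 -rising_opp.
Qed.

End FallingRising.

(** * Symmetrized products in the Heisenberg relations *)

(** This is [T(p,q;c)]. As [p - m] truncates at 0, terms with [m > p] are meaningful only when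
    [c m = 0], whence the side conditions on [p < m <= q] below. *)
Definition sym_sum {R : numFieldType} {V : lmodType R} (s : nat -> nat -> nat -> V)
    (p q : nat) (c : nat -> R) : V :=
  \sum_(m < q.+1) (c m * 'C(q, m)%:R / 2 ^+ m) *: s (p - m)%N (q - m)%N m.

Section SymmetrizedRelations.
Context {R : numFieldType} {V : lmodType R}.
(** [s p q r] models a symmetrized product applied to a fixed vector. The scalar [e] is left free so
    that [X] and [Y] can be exchanged, with [e = -1]. *)
Variables (X Y Z : {linear V -> V}) (s : nat -> nat -> nat -> V) (e : R).
Hypothesis YX : forall v, Y (X v) = X (Y v) + e *: Z v.
Hypothesis ZX : forall v, Z (X v) = X (Z v).
Hypothesis ZY : forall v, Z (Y v) = Y (Z v).
Hypothesis s_rec : forall p q r, (p + q + r)%:R *: s p q r =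
  p%:R *: X (s p.-1 q r) + q%:R *: Y (s p q.-1 r) + r%:R *: Z (s p q r.-1).

(** Induction on the degree: as [Z] commutes with [X] and [Y], applying it to the recursion for
    [s p q r] gives the recursion for [s p q r.+1] up to one copy of [Z (s p q r)], which accounts
    for [r.+1] in place of [r]. *)
Lemma sym_Z p q r : Z (s p q r) = s p q r.+1.
Proof.
have [n] := ubnP (p + q + r); elim: n => // n IH in p q r *; rewrite ltnS => le_n.
have nz : ((p + q + r.+1)%:R : R) != 0 by rewrite pnatr_eq0 addnS.
apply: (scalerI nz); rewrite s_rec /=.
have -> : (p + q + r.+1)%:R *: Z (s p q r) =
    Z ((p + q + r)%:R *: s p q r) + Z (s p q r).
  by rewrite linearZ_LR addnS -natr1 scalerDl scale1r.
rewrite s_rec -[r.+1%:R]natr1 scalerDl scale1r addrA.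
rewrite !linearD !linearZ_LR /= ZX ZY; congr (_ + _ + _ + _).
- by case: p {nz} le_n => [|p] le_n; rewrite ?scale0r //= IH //; lia.
- by case: q {nz} le_n => [|q] le_n; rewrite ?scale0r //= IH //; lia.
- by case: r {nz} le_n => [|r] le_n; rewrite ?scale0r //= IH //; lia.
Qed.

(** Induction on the degree: expand [s p.+1 q r] by the recursion and pull [X] to the front of each
    term; the induction hypothesis and [YX] produce the corrections. *)
Lemma sym_X p q r :
  X (s p q r) = s p.+1 q r - (e * q%:R / 2) *: s p q.-1 r.+1.
Proof.
have [n] := ubnP (p + q + r); elim: n => // n IH in p q r *; rewrite ltnS => le_n.
have IH' p' q' r' : (p' + q' + r' < n)%N -> s p'.+1 q' r' =
    X (s p' q' r') + (e * q'%:R / 2) *: s p' q'.-1 r'.+1.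
  by move=> lt_n; rewrite IH // subrK.
have nz : ((p.+1 + q + r)%:R : R) != 0 by rewrite pnatr_eq0.
apply/eqP; rewrite eq_sym subr_eq; apply/eqP/(scalerI nz).
rewrite scalerDr s_rec /= !addSn -(natr1 p) -(natr1 (p + q + r)) !scalerDl !scale1r.
have -> : p%:R *: X (s p q r) = p%:R *: X (X (s p.-1 q r)) +
    (e * q%:R * p%:R / 2) *: X (s p.-1 q.-1 r.+1).
  case: p {nz} le_n => [|p] le_n; first by rewrite !(mulr0, mul0r, scale0r) addr0.
  rewrite /= IH' // linearD linearZ_LR /= scalerDr scalerA.
  by congr (_ + _ *: _); ring.
have -> : q%:R *: Y (s p.+1 q.-1 r) = q%:R *: X (Y (s p q.-1 r)) +
    (e * q%:R) *: s p q.-1 r.+1 +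
    (e * q%:R * q.-1%:R / 2) *: Y (s p q.-2 r.+1).
  case: q {nz} le_n => [|q] le_n; first by rewrite !(mulr0, mul0r, scale0r) !addr0.
  rewrite /= IH'; last by lia.
  rewrite linearD linearZ_LR /= YX sym_Z !scalerDr !scalerA.
  by congr (_ + _ *: _ + _ *: _); ring.
have -> : r%:R *: Z (s p.+1 q r.-1) = r%:R *: X (Z (s p q r.-1)) +
    (e * q%:R * r%:R / 2) *: s p q.-1 r.+1.
  case: r {nz} le_n => [|r] le_n; first by rewrite !(mulr0, mul0r, scale0r) addr0.
  rewrite /= IH'; last by lia.
  rewrite linearD linearZ_LR /= ZX !sym_Z scalerDr scalerA.
  by congr (_ + _ *: _); ring.
have hX : (p + q + r)%:R *: X (s p q r) = p%:R *: X (X (s p.-1 q r)) +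
    q%:R *: X (Y (s p q.-1 r)) + r%:R *: X (Z (s p q r.-1)).
  by rewrite -linearZ_LR s_rec !linearD !linearZ_LR.
have hS : (e * q%:R * (p + q + r)%:R / 2) *: s p q.-1 r.+1 =
    (e * q%:R * p%:R / 2) *: X (s p.-1 q.-1 r.+1) +
    (e * q%:R * q.-1%:R / 2) *: Y (s p q.-2 r.+1) +
    (e * q%:R * r.+1%:R / 2) *: s p q.-1 r.+1.
  case: q {le_n hX nz} => [|q]; first by rewrite !(mulr0, mul0r, scale0r) !addr0.
  have /= := s_rec p q r.+1; rewrite sym_Z addnS.
  move/(congr1 (GRing.scale (e * q.+1%:R / 2))).
  rewrite !scalerDr !scalerA addnS addSn => E.
  by rewrite mulrAC E; congr (_ *: _ + _ *: _ + _ *: _); ring.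
move/eqP: hS; rewrite -subr_eq => /eqP hS.
(* The terms led by [X] collapse by [hX], the two corrections led by [X] and [Y] by [hS]. Multiples
   of [s p q.-1 r.+1] remain, with coefficients [e q (p+q+r)/2 - e q (r+1)/2 + e q + e q r/2 = e q
   (p+q+r+1)/2]. *)
rewrite (AC (3*3*2) ((1*4*7)*3*((2*6)*(5*8)))) /= -hX -hS; congr (_ + _).
rewrite scalerA -scalerBl -!scalerDl; congr (_ *: _).
by rewrite -natr1; field.
Qed.

(** The generating function of [c] is multiplied by [1 - e t], through
    [(m+1) C(q,m+1) = (q-m) C(q,m)]. The vanishing hypothesis covers the indices at which
    [(p - m).+1] and [p.+1 - m] differ. *)
Lemma sym_X_sum p q (c : nat -> R) : (forall m, (p < m <= q)%N -> c m = 0) ->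
  X (sym_sum s p q c) = sym_sum s p.+1 q (fun m => c m - e * m%:R * c m.-1).
Proof.
move=> c0; rewrite /sym_sum linear_sum /=.
under eq_bigr => m _ do rewrite linearZ_LR /= sym_X scalerBr scalerA -subnS.
under [RHS]eq_bigr => m _ do rewrite mulrBl mulrBl scalerBl.
rewrite !sumrB; congr (_ - _).
  apply: eq_bigr => m _; have [mp|pm] := leqP m p; first by rewrite subSn.
  have /c0 -> : (p < m <= q)%N by rewrite pm -[(m <= q)%N]ltnS ltn_ord.
  by rewrite !mul0r !scale0r.
(* The correction of index [m] matches index [m + 1] on the right: the last correction carries
   [q - q = 0], and index 0 on the right carries the factor [m = 0]. *)
rewrite big_ord_recr /= subnn !(mulr0, mul0r, scale0r) addr0.
rewrite big_ord_recl /= !(mulr0, mul0r, scale0r) add0r.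
apply: eq_bigr => m _; rewrite /bump /= add1n subSS; congr (_ *: _).
have -> : e * m.+1%:R * c m * 'C(q, m.+1)%:R = e * c m * (m.+1 * 'C(q, m.+1))%:R.
  by rewrite natrM; ring.
rewrite mul_bin_left natrM exprS; field.
by rewrite expf_neq0.
Qed.
End SymmetrizedRelations.

(** * Factorizations in a module with Heisenberg relations *)

Section Factorizations.
Context {R : numFieldType} {V : lmodType R}.
Variables (X Y Z : {linear V -> V}) (s : nat -> nat -> nat -> V).
Hypothesis YX : forall v, Y (X v) = X (Y v) + Z v.
Hypothesis ZX : forall v, Z (X v) = X (Z v).
Hypothesis ZY : forall v, Z (Y v) = Y (Z v).
Hypothesis s_rec : forall p q r, (p + q + r)%:R *: s p q r =
  p%:R *: X (s p.-1 q r) + q%:R *: Y (s p q.-1 r) + r%:R *: Z (s p q r.-1).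

(** The same family with the roles of [X] and [Y] exchanged, for which [e = -1]. *)
Let s' p q r := s q p r.

Lemma iter_sym_X d p q u v :
  (forall i m, (i < d)%N -> (p + i < m <= q)%N -> cay m u (v - i%:R) = 0) ->
  iter d X (sym_sum s p q (fun m => cay m u v)) =
  sym_sum s (p + d) q (fun m => cay m u (v - d%:R)).
Proof.
have YX1 w : Y (X w) = X (Y w) + 1 *: Z w by rewrite scale1r.
elim: d => [|d IH] c0; first by rewrite addn0 subr0.
rewrite iterS IH => [|i m id]; last by apply: c0; rewrite ltnS ltnW.
rewrite (sym_X_sum _ _ _ _ _ YX1 ZX ZY s_rec) => [|m]; last exact: c0.
by rewrite addnS; apply: eq_bigr => m _; rewrite -(natr1 d) opprD addrA cay_pred mul1r.
Qed.

Lemma iter_sym_Y d p q u v :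
  (forall i m, (i < d)%N -> (p + i < m <= q)%N -> cay m (u + i%:R) v = 0) ->
  iter d Y (sym_sum s' p q (fun m => cay m u v)) =
  sym_sum s' (p + d) q (fun m => cay m (u + d%:R) v).
Proof.
have XY w : X (Y w) = Y (X w) + (-1) *: Z w by rewrite YX scaleN1r addrK.
have s'_rec p' q' r : (p' + q' + r)%:R *: s' p' q' r =
    p'%:R *: Y (s' p'.-1 q' r) + q'%:R *: X (s' p' q'.-1 r) + r%:R *: Z (s' p' q' r.-1).
  by rewrite /s' (addnC p') s_rec (addrC (p'%:R *: _)).
elim: d => [|d IH] c0; first by rewrite addn0 addr0.
rewrite iterS IH => [|i m id]; last by apply: c0; rewrite ltnS ltnW.
rewrite (sym_X_sum _ _ _ _ _ XY ZY ZX s'_rec) => [|m]; last exact: c0.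
rewrite addnS; apply: eq_bigr => m _; rewrite -(natr1 d) addrA cay_succ.
by congr (_ * _ / _ *: _); ring.
Qed.

Definition Dpm_sum sign a b : V :=
  \sum_(m < (minn a b).+1)
     ((if sign then 1 else -1) ^+ m / 2 ^+ m * (m`!)%:R
        * ('C(a, m))%:R * ('C(b, m))%:R) *: s (a - m) (b - m) m.

Definition Dc_sum (x : R) a : V :=
  \sum_(m < a.+1)
     ((2 ^+ m)^-1 * ('C(a, m))%:R * Cay m x a%:R) *: s (a - m) (a - m) m.

Lemma sym_sum_minn t a b (c : nat -> R) : (forall m, (a < m)%N -> c m = 0) ->
  sym_sum t a b c =
  \sum_(m < (minn a b).+1) (c m * 'C(b, m)%:R / 2 ^+ m) *: t (a - m)%N (b - m)%N m :> V.
Proof.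
move=> c0; have [ab|ba] // := ltnP a b.
pose F m := (c m * 'C(b, m)%:R / 2 ^+ m) *: t (a - m)%N (b - m)%N m.
rewrite (big_ord_widen b.+1 F) ?ltnS 1?ltnW // /F.
rewrite /sym_sum [RHS]big_mkcond; apply: eq_bigr => m _; rewrite ltnS.
by have [//|/c0 ->] := leqP m a; rewrite !mul0r scale0r.
Qed.

(** [m! C(k,m)] is a falling factorial, with generating function [(1+t)^k]. The coefficients of
    [D_+] are symmetric in [k] and [l], so it is also a sum over [s'] with [(1+t)^l]: the first form
    suits the action of [X], the second that of [Y]. *)
Lemma Dp_sumX k l : Dpm_sum true k l = sym_sum s k l (fun m => cay m k%:R 0).
Proof.
rewrite sym_sum_minn => [|m km]; last by rewrite cay_v0 falling_small.
apply: eq_bigr => m _; rewrite cay_v0 falling_nat expr1n natrM.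
by congr (_ *: _); ring.
Qed.

Lemma Dp_sumY k l : Dpm_sum true k l = sym_sum s' l k (fun m => cay m l%:R 0).
Proof.
rewrite sym_sum_minn => [|m lm]; last by rewrite cay_v0 falling_small.
rewrite minnC; apply: eq_bigr => m _; rewrite cay_v0 falling_nat expr1n natrM.
by congr (_ *: _); ring.
Qed.

(** With the sign, [m! C(k,m)] becomes the rising factorial of [-k], with generating function
    [(1-t)^k]. *)
Lemma Dm_sumX k l : Dpm_sum false k l = sym_sum s k l (fun m => cay m 0 (- k%:R)).
Proof.
rewrite sym_sum_minn => [|m km]; last by rewrite cay_0v rising_opp falling_small ?mulr0.
apply: eq_bigr => m _; rewrite cay_0v rising_opp falling_nat natrM.
by congr (_ *: _); ring.
Qed.

Lemma Dm_sumY k l : Dpm_sum false k l = sym_sum s' l k (fun m => cay m 0 (- l%:R)).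
Proof.
rewrite sym_sum_minn => [|m lm]; last by rewrite cay_0v rising_opp falling_small ?mulr0.
rewrite minnC; apply: eq_bigr => m _; rewrite cay_0v rising_opp falling_nat natrM.
by congr (_ *: _); ring.
Qed.

Lemma Dc_sumE x a : Dc_sum x a =
  sym_sum s a a (fun m => cay m ((x + a%:R) / 2) ((x - a%:R) / 2)).
Proof.
by apply: eq_bigr => m _; rewrite /Cay -/(cay m _ _); congr (_ *: _); ring.
Qed.

Lemma sym_sum_swap a c : sym_sum s' a a c = sym_sum s a a c.
Proof. by []. Qed.

Lemma sym_p00 p : s p 0 0 = iter p X (s 0 0 0).
Proof.
elim: p => // p IH; rewrite iterS -IH; apply: (@scalerI _ _ p.+1%:R).
  by rewrite pnatr_eq0.
by have := s_rec p.+1 0 0; rewrite !addn0 !scale0r !addr0.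
Qed.

Lemma sym_0q0 q : s 0 q 0 = iter q Y (s 0 0 0).
Proof.
elim: q => // q IH; rewrite iterS -IH; apply: (@scalerI _ _ q.+1%:R).
  by rewrite pnatr_eq0.
by have := s_rec 0 q.+1 0; rewrite addn0 !scale0r addr0 add0r.
Qed.

Lemma sym_sum0 t q : sym_sum t 0 q (fun m => cay m 0 0 : R) = t 0 q 0 :> V.
Proof.
rewrite sym_sum_minn => [|m m0]; last by rewrite cay_0v rising0.
by rewrite min0n big_ord1 cay_0v /rising big_ord0 bin0 expr0 !mul1r invr1 scale1r !subn0.
Qed.

(** [X^k] is the sum over [s'] with first index 0 and generating function 1, which [l] applications
    of [Y] turn into [(1+t)^l]. After [i] steps the degree is [i], equal to the first index, so the
    vanishing condition holds. *)
Lemma Dp_sum_factor k l : Dpm_sum true k l = iter l Y (iter k X (s 0 0 0)).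
Proof.
rewrite -sym_p00 -[s k 0 0](sym_sum0 s') iter_sym_Y => [|i m _ /andP[im _]].
  by rewrite Dp_sumY !add0r.
by rewrite add0r cay_v0 falling_small.
Qed.

Lemma Dm_sum_factor k l : Dpm_sum false k l = iter k X (iter l Y (s 0 0 0)).
Proof.
rewrite -sym_0q0 -[s 0 l 0](sym_sum0 s) iter_sym_X => [|i m _ /andP[im _]].
  by rewrite Dm_sumX !add0r.
by rewrite add0r cay_0v rising_opp falling_small ?mulr0.
Qed.

(** Here [u = k] and [v = k - l]: the generating function [(1+t)^k (1-t)^(l-k)] is that of [D_+]
    times [l - k] factors [1 - t]. *)
Lemma Dc_sum_factorX k l : (k <= l)%N ->
  Dc_sum ((2 * k)%:R - l%:R) l = iter (l - k) X (Dpm_sum true k l).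
Proof.
move=> kl; rewrite Dp_sumX iter_sym_X => [|i m _ /andP[im _]]; last first.
  by rewrite sub0r cay_small.
rewrite subnKC // Dc_sumE; apply: eq_bigr => m _; congr (cay m _ _ * _ / _ *: _);
  by rewrite ?natrB // natrM; field.
Qed.

(** Here [u = k - l] and [v = -l], so [D_-] acquires [k - l] factors [1 + t]. *)
Lemma Dc_sum_factorY k l : (l <= k)%N ->
  Dc_sum (k%:R - (2 * l)%:R) k = iter (k - l) Y (Dpm_sum false k l).
Proof.
move=> lk; rewrite Dm_sumY iter_sym_Y => [|i m _ /andP[im _]]; last first.
  by rewrite add0r cay_small // addnC.
rewrite subnKC // Dc_sumE -sym_sum_swap; apply: eq_bigr => m _.
congr (cay m _ _ * _ / _ *: _); by rewrite ?natrB // natrM; field.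
Qed.

(** Now [v = k - l] is nonnegative, and the factors [1 - t] cancel [(1-t)^(l-k)], leaving
    [(1+t)^k]. *)
Lemma iterX_Dc_sum k l : (l <= k)%N ->
  iter (k - l) X (Dc_sum ((2 * k)%:R - l%:R) l) = Dpm_sum true k l.
Proof.
move=> lk; rewrite Dc_sumE iter_sym_X => [|i m _ lm]; last by lia.
rewrite subnKC // Dp_sumX; apply: eq_bigr => m _; congr (cay m _ _ * _ / _ *: _);
  by rewrite ?natrB // natrM; field.
Qed.

Lemma iterY_Dc_sum k l : (k <= l)%N ->
  iter (l - k) Y (Dc_sum (k%:R - (2 * l)%:R) k) = Dpm_sum false k l.
Proof.
move=> kl; rewrite Dc_sumE -sym_sum_swap iter_sym_Y => [|i m _ lm]; last by lia.
rewrite subnKC // Dm_sumY; apply: eq_bigr => m _; congr (cay m _ _ * _ / _ *: _);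
  by rewrite ?natrB // natrM; field.
Qed.

End Factorizations.

(** * Averages over words *)

Lemma big_tuple_cons (V : nmodType) (T : finType) n (P : pred (seq T)) (F : seq T -> V) :
  \sum_(w : n.+1.-tuple T | P w) F w =
  \sum_(i : T) \sum_(w : n.-tuple T | P (i :: w)) F (i :: w).
Proof.
rewrite pair_big_dep /= (reindex (fun x : T * n.-tuple T => [tuple of x.1 :: x.2])) //=.
exists (fun w => (thead w, [tuple of behead w])) => [[i w] _ | w _] /=.
  by congr pair; apply/val_inj.
by rewrite [RHS]tuple_eta; apply/val_inj.
Qed.

Section WordSums.
Context {R : numFieldType} {V : lmodType R}.
Variable D : 'I_3 -> {linear V -> V}.

Definition words p q : pred (seq 'I_3) :=
  fun w => (count_mem i0 w == p) && (count_mem i1 w == q).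

Definition word_sum n p q v : V :=
  \sum_(w : n.-tuple 'I_3 | words p q w) foldr (fun i => D i) v w.

Lemma word_sum0 p q v : word_sum 0 p q v = if (p == 0) && (q == 0) then v else 0.
Proof.
rewrite /word_sum; under eq_bigr => w _ do rewrite tuple0 /=.
rewrite big_mkcond (eq_bigr (fun=> if (p == 0) && (q == 0) then v else 0)).
  by rewrite sumr_const card_tuple expn0 mulr1n.
by move=> w _; rewrite tuple0 /words /= ![0 == _]eq_sym.
Qed.

Lemma word_sumS n p q v : word_sum n.+1 p q v =
  (if p is p'.+1 then D i0 (word_sum n p' q v) else 0) +
  (if q is q'.+1 then D i1 (word_sum n p q' v) else 0) + D i2 (word_sum n p q v).
Proof.
rewrite /word_sum big_tuple_cons !big_ord_recl big_ord0 addr0 addrA.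
have -> : ord0 = i0 by apply/val_inj.
have -> : lift i0 ord0 = i1 by apply/val_inj.
have -> : lift i0 (lift ord0 ord0) = i2 by apply/val_inj.
congr (_ + _ + _).
- case: p => [|p]; first by rewrite big_pred0.
  by rewrite linear_sum.
- case: q => [|q]; first by rewrite big_pred0 // => w; rewrite /words /= andbF.
  by rewrite linear_sum.
- by rewrite linear_sum.
Qed.

Lemma word_sum_small n p q v : (n < p + q)%N -> word_sum n p q v = 0.
Proof.
elim: n => [|n IH] in p q *; first by rewrite word_sum0; case: p; case: q.
rewrite word_sumS => npq; rewrite IH ?(linear0, addr0); last by lia.
case: p npq => [|p] npq; case: q npq => [|q] npq; rewrite ?IH ?linear0 ?addr0 //; lia.
Qed.
End WordSums.

(** With every operator the identity of the rationals, [word_sum] counts words; the multinomial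
    formula then follows from the recursion on the first letter. *)
Lemma card_words n p q : (p + q <= n)%N ->
  (#|[pred w : n.-tuple 'I_3 | words p q w]| * (p`! * q`! * (n - (p + q))`!))%N = n`!.
Proof.
pose D (i : 'I_3) : {linear rat^o -> rat^o} := idfun.
have cardE m a b :
    #|[pred w : m.-tuple 'I_3 | words a b w]|%:R = word_sum D m a b (1 : rat^o).
  rewrite -sumr_const; apply: eq_bigr => w _; elim: (tval w) => //.
suff H : (p + q <= n)%N ->
   word_sum D n p q (1 : rat^o) * (p`! * q`! * (n - (p + q))`!)%:R = n`!%:R.
  by move=> /H; rewrite -cardE -natrM => /eqP; rewrite eqr_nat => /eqP.
elim: n => [|n IH] in p q *.
  by rewrite leqn0 addn_eq0 => /andP[/eqP-> /eqP->]; rewrite word_sum0 mul1r.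
move=> pqn; rewrite word_sumS /= !mulrDl (factS n) (natrM _ n.+1).
have -> : n.+1%:R = p%:R + q%:R + (n.+1 - (p + q))%:R :> rat.
  by rewrite -!natrD subnKC.
rewrite !mulrDl; congr (_ + _ + _).
- case: p pqn => [|p] pqn; first by rewrite !mul0r.
  rewrite -(IH p q) // addSn subSS factS !natrM; ring.
- case: q pqn => [|q] pqn; first by rewrite !mul0r.
  by rewrite -(IH p q) ?addnS ?subSS ?factS ?natrM //; [ring | lia].
- have [le|lt] := leqP (p + q) n.
    by rewrite -(IH p q) // subSn // factS !natrM; ring.
  by rewrite word_sum_small // (_ : n.+1 - _ = 0)%N ?mul0r //; lia.
Qed.

Section SymmetrizedWords.
Context {R : numFieldType} {V : lmodType R}.
Variable D : 'I_3 -> {linear V -> V}.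

Definition sym_words v p q r : V :=
  (#|@orderings p q r|%:R)^-1 *:
    \sum_(w in @orderings p q r) foldr (fun i => D i) v w.

Lemma sym_wordsE v p q r : sym_words v p q r =
  ((p`! * q`! * r`!)%:R / (p + q + r)`!%:R) *: word_sum D (p + q + r) p q v.
Proof.
have := @card_words (p + q + r) p q; rewrite leq_addr addKn => /(_ isT) <-.
rewrite /sym_words [(#|_| * _)%:R]natrM invfM mulrCA divff ?mulr1 //.
Qed.

Lemma sym_words0 v : sym_words v 0 0 0 = v.
Proof. by rewrite sym_wordsE word_sum0 divff ?scale1r // oner_eq0. Qed.

(** Words are split at their first letter; the multinomial normalization produces the weights [p],
    [q], [r]. *)
Lemma sym_words_rec v p q r : (p + q + r)%:R *: sym_words v p q r =
  p%:R *: D i0 (sym_words v p.-1 q r) + q%:R *: D i1 (sym_words v p q.-1 r) +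
  r%:R *: D i2 (sym_words v p q r.-1).
Proof.
case En: (p + q + r)%N => [|n].
  have [-> -> ->] : [/\ p = 0, q = 0 & r = 0]%N by split; lia.
  by rewrite !scale0r !addr0.
have n0 : n`!%:R != 0 :> R by rewrite pnatr_eq0 -lt0n fact_gt0.
rewrite !sym_wordsE !(linearZ_LR (D _)) !scalerA En word_sumS (factS n) (natrM _ n.+1).
set c := _ * _; have -> : c = (p`! * q`! * r`!)%:R / n`!%:R.
  by rewrite /c; field; rewrite n0 addrC natr1 pnatr_eq0.
rewrite !scalerDr; congr (_ + _ + _).
- case: p En {c} => [|p] En; first by rewrite mul0r scale0r scaler0.
  have -> : (p + q + r)%N = n by lia.
  by rewrite factS !natrM; congr (_ *: _); ring.
- case: q En {c} => [|q] En; first by rewrite mul0r scale0r scaler0.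
  have -> : (p + q + r)%N = n by lia.
  by rewrite factS !natrM; congr (_ *: _); ring.
- case: r En {c} => [|r] En.
    by rewrite mul0r scale0r word_sum_small ?linear0 ?scaler0 //; lia.
  have -> : (p + q + r)%N = n by lia.
  by rewrite factS !natrM; congr (_ *: _); ring.
Qed.
End SymmetrizedWords.

(** * Symmetry of second derivatives *)

Section MeanValueInequality.
Context {R : realType} {W : normedModType R}.
Implicit Types (g : R -> W) (a b t M e : R).

(** The slack between [M] and the norm of the derivative absorbs the first-order remainder. *)
Lemma derivable_growth g t M : derivable g t 1 -> `|'D_1 g t| < M ->
  exists2 d, 0 < d & forall h, `|h| < d -> `|g (t + h) - g t| <= M * `|h|.
Proof.
move=> /derivable_nbhs /eqaddoP gt DM.
have e0 : 0 < M - `|'D_1 g t| by rewrite subr_gt0.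
have /nbhs_ballP[d /= d0 dP] := gt _ e0.
exists d => // h hd; have := dP h; rewrite /ball /= sub0r normrN => /(_ hd).
rewrite /= !fctE /= [h *: 1]mulr1 (addrC h) /= => H.
have -> : g (t + h) - g t = g (t + h) - (g t + h *: 'D_1 g t) + h *: 'D_1 g t.
  by rewrite opprD addrA subrK.
apply: (le_trans (ler_normD _ _)); rewrite normrZ.
by apply: (le_trans (lerD H (lexx _))); lra.
Qed.

(* Any [M' > M] bounds the growth of [g] near each point, so the set of [t]
   satisfying the inequality with [M'] contains its supremum, which must be [b]. *)
Lemma mean_value_ineq g M a b : (forall t, derivable g t 1) -> a <= b ->
  (forall t, a <= t <= b -> `|'D_1 g t| <= M) -> `|g b - g a| <= M * (b - a).
Proof.
move=> dg ab gM.
suff H M' : M < M' -> `|g b - g a| <= M' * (b - a).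
  apply/ler_addgt0Pr => e e0.
  (* The [+ 1] keeps the divisor positive when [a = b]. *)
  have d0 : 0 < b - a + 1 by lra.
  apply: (le_trans (H (M + e / (b - a + 1)) _)); first by rewrite ltrDl divr_gt0.
  rewrite mulrDl lerD2l mulrAC ler_pdivrMr //; apply: ler_pM; lra.
move=> MM'.
pose A := [set t | a <= t <= b /\ `|g t - g a| <= M' * (t - a)]%classic.
have Aa : A a by rewrite /A /= subrr normr0 lexx ab subrr mulr0.
have supA : has_sup A by split; [exists a | exists b => t [/andP[]]].
set s := sup A.
have as_ : a <= s by apply: sup_upper_bound.
have sb : s <= b by apply: ge_sup => //; [exists a | move=> t [/andP[]]].
have growth t : a <= t <= b ->
    exists2 d, 0 < d & forall h, `|h| < d -> `|g (t + h) - g t| <= M' * `|h|.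
  by move=> tab; apply: derivable_growth => //; apply: le_lt_trans MM'; exact: gM.
have [d d0 dP] := growth s (introT andP (conj as_ sb)).
have As : `|g s - g a| <= M' * (s - a).
  have [t At st] := sup_adherent d0 supA.
  have ts : t <= s by apply: sup_upper_bound.
  have [_ gt] := At; have := dP (t - s).
  rewrite (addrC s) subrK (distrC t) ger0_norm ?subr_ge0 // -/s => /(_ _) H.
  have {}H : `|g t - g s| <= M' * (s - t) by apply: H; rewrite -/s in st; lra.
  apply: (le_trans (ler_distD (g t) _ _)); rewrite distrC.
  by apply: (le_trans (lerD H gt)); lra.
have [bs|sb'] := leP b s; first by have -> : b = s by apply/le_anti; rewrite bs sb.
(* If [s < b], this step stays inside the growth radius at [s] and does not pass [b], so [s + h]
   would be a point of [A] above its supremum. *)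
pose h := Num.min (d / 2) (b - s).
have h0 : 0 < h by rewrite /h lt_min divr_gt0 //= subr_gt0.
have hd : h < d by rewrite /h gt_min; apply/orP; left; lra.
have hb : h <= b - s by rewrite /h ge_min lexx orbT.
have : s + h <= s.
  apply: sup_upper_bound => //; split; first by lra.
  have := dP h; rewrite (gtr0_norm h0) => /(_ hd) H.
  apply: (le_trans (ler_distD (g s) _ _)).
  by apply: (le_trans (lerD H As)); lra.
by lra.
Qed.
End MeanValueInequality.

Section Schwarz.
Context {R : realType} {V W : normedModType R}.
Implicit Types (f : V -> W) (u v p : V).

Let line_growth f q u (t : R) :
  (fun h : R => h^-1 *: (((fun r : R => f (q + r *: u)) \o shift t) (h *: (1 : R))
     - f (q + t *: u))) =
  (fun h : R => h^-1 *: ((f \o shift (q + t *: u)) (h *: u) - f (q + t *: u))).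
Proof. by apply/funext => h /=; rewrite [h *: 1]mulr1 scalerDl addrCA. Qed.

Lemma derive_line f q u (t : R) :
  'D_1 (fun r : R => f (q + r *: u)) t = 'D_u f (q + t *: u).
Proof. by rewrite /derive line_growth. Qed.

Lemma derivable_line f q u (t : R) : derivable f (q + t *: u) u ->
  derivable (fun r : R => f (q + r *: u)) t 1.
Proof. by rewrite /derivable line_growth. Qed.

(** The second difference, less its expected value, is an increment over [[0, h]] of a function of
    [t] moving along [u]; the mean value inequality reduces its bound to the differentiability of
    ['D_u f] at [p]. *)
Lemma second_difference f p u v (e : R) :
  (forall x, differentiable f x) -> differentiable (fun x => 'D_u f x) p -> 0 < e ->
  exists2 d : R, 0 < d & forall h, 0 < h -> h < d ->
  `|f (p + h *: u + h *: v) - f (p + h *: u) - f (p + h *: v) + f p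
     - (h * h) *: 'D_v (fun x => 'D_u f x) p| <= e * (h * h).
Proof.
move=> df dfu e0.
(* Both displacements [h v + t u] and [t u] have norm at most [h C], so two remainders with constant
   [e / (2 C)] add up to at most [e h]. *)
set C := `|u| + `|v| + 1.
have C0 : 0 < C by rewrite ltr_wpDl // addr_ge0.
have eC : 0 < e / (2 * C) by rewrite divr_gt0 // mulr_gt0.
rewrite deriveE //; set L := 'd _ p.
have /eqaddoP /(_ _ eC) /nbhs_ballP[d /= d0 dP] := diff_locally dfu.
have {}dP w : `|w| < d -> `|'D_u f (p + w) - 'D_u f p - L w| <= e / (2 * C) * `|w|.
  move=> wd; have := dP w; rewrite -ball_normE /ball_ /= sub0r normrN => /(_ wd).
  by rewrite /= !fctE /= (addrC w) opprD addrA.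
exists (d / C) => [|h h0 hd]; first by rewrite divr_gt0.
(* The derivative of [g] is a difference of two first-order remainders of
   ['D_u f] at [p]. *)
pose g (t : R) := f (p + h *: v + t *: u) - f (p + t *: u) - t *: (h *: L v).
have dline q (t : R) : derivable (fun r : R => f (q + r *: u)) t 1.
  exact/derivable_line/diff_derivable.
have dlin (t : R) : is_derive t 1 (fun r : R => r *: (h *: L v)) (h *: L v).
  split; first exact/diff_derivable/differentiableZl.
  by rewrite deriveE ?diffZl ?diff_val ?scale1r //; exact: differentiableZl.
have dg (t : R) : is_derive t 1 g
    ('D_u f (p + h *: v + t *: u) - 'D_u f (p + t *: u) - h *: L v).
  rewrite -!derive_line; apply: is_deriveB; apply: is_deriveB;
  exact/derivableP/dline.
have gM (t : R) : 0 <= t <= h -> `|'D_1 g t| <= e * h.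
  case/andP=> t0 th; have -> := @derive_val _ _ _ _ _ _ _ (dg t).
  have nC (w : V) : `|w| <= h * C -> `|w| < d.
    by move=> wh; apply: (le_lt_trans wh); rewrite -ltr_pdivlMr.
  have hCE : h * C = h * `|u| + h * `|v| + h by rewrite /C; ring.
  have tu : `|t *: u| <= h * `|u| by rewrite normrZ ger0_norm // ler_wpM2r.
  have hv : `|h *: v| = h * `|v| by rewrite normrZ gtr0_norm.
  have hu0 : 0 <= h * `|u| by rewrite mulr_ge0 // ltW.
  have hv0 : 0 <= h * `|v| by rewrite mulr_ge0 // ltW.
  have le1 : `|h *: v + t *: u| <= h * C.
    by apply: (le_trans (ler_normD _ _)); rewrite hCE; lra.
  have le2 : `|t *: u| <= h * C by rewrite hCE; lra.
  have H1 := dP _ (nC _ le1); have H2 := dP _ (nC _ le2).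
  have -> : 'D_u f (p + h *: v + t *: u) - 'D_u f (p + t *: u) - h *: L v =
    ('D_u f (p + (h *: v + t *: u)) - 'D_u f p - L (h *: v + t *: u)) -
    ('D_u f (p + t *: u) - 'D_u f p - L (t *: u)).
    rewrite linearD [L (h *: v)]linearZ_LR addrA; set a := 'D_u f _; set b := 'D_u f _.
    set c := 'D_u f p; set x := _ *: _; set y := L _.
    by rewrite !opprD !opprK (AC (2*2*3) (1*5*3*(2*6)*(4*7))) /= !addNr !addr0.
  apply: (le_trans (ler_normB _ _)); apply: (le_trans (lerD H1 H2)).
  rewrite -mulrDr; apply: (@le_trans _ _ (e / (2 * C) * (h * C + h * C))).
    by rewrite ler_pM2l // lerD.
  by rewrite le_eqVlt; apply/orP; left; apply/eqP; field; rewrite gt_eqF.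
have dg' t : derivable g t 1 by case: (dg t).
have := mean_value_ineq g (e * h) 0 h dg' (ltW h0) gM.
rewrite /g !scale0r !addr0 subr0 subr0 scalerA -mulrA; congr (`|_| <= _).
by rewrite opprB addrA (addrAC p) (AC 5 (1*2*5*4*3)).
Qed.

(** The second difference is symmetric in [u] and [v], and both mixed derivatives, scaled by [h^2],
    approximate it up to [(e/2) h^2]. *)
Lemma derive_comm f p u v : (forall x, differentiable f x) ->
  differentiable (fun x => 'D_u f x) p -> differentiable (fun x => 'D_v f x) p ->
  'D_v (fun x => 'D_u f x) p = 'D_u (fun x => 'D_v f x) p.
Proof.
move=> df du dv; apply/eqP; rewrite -subr_eq0 -normr_le0.
apply/ler_addgt0Pr => e e0; rewrite add0r.
have e2 : 0 < e / 2 by rewrite divr_gt0.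
have [d1 d10 H1] := second_difference f p u v _ df du e2.
have [d2 d20 H2] := second_difference f p v u _ df dv e2.
pose h := Num.min d1 d2 / 2.
have m0 : 0 < Num.min d1 d2 by rewrite lt_min d10.
have h0 : 0 < h by rewrite divr_gt0.
have hm : h < Num.min d1 d2 by rewrite /h; lra.
have := hm; rewrite lt_min => /andP[/(H1 _ h0) {}H1 /(H2 _ h0) {}H2].
have hh : 0 < h * h by rewrite mulr_gt0.
rewrite -(ler_pM2l hh) -{1}(gtr0_norm hh) -normrZ scalerBr.
rewrite (addrAC p (h *: v)) [X in X + f p]addrAC in H2.
move: H1 H2; set A := (h * h) *: 'D_v _ p; set B := (h * h) *: 'D_u _ p.
set F := _ + f p => H1 H2.
have -> : A - B = (F - B) - (F - A) by rewrite opprB [RHS]addrC addrA subrK.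
by apply: (le_trans (ler_normB _ _)); apply: (le_trans (lerD H2 H1)); lra.
Qed.
End Schwarz.

(** * Product rule for a scalar function times a vector-valued one *)

Section ScaleDifferential.
Context {R : realType} {V W : normedModType R}.

Let scale_is_bilinear : bilinear_for
  (GRing.Scale.Law.clone _ _ *:%R _) (GRing.Scale.Law.clone _ _ *:%R _)
  (@GRing.scale R W : R -> W -> W).
Proof.
split=> [w|r] a x y /=; first by rewrite scalerDl scalerA.
by rewrite scalerDr !scalerA mulrC.
Qed.
HB.instance Definition _ := bilinear_isBilinear.Build R R W W _ _
  (@GRing.scale R W) scale_is_bilinear.

(** Chain rule for [y -> (k y, f y)] followed by the continuous bilinear map [(r, w) -> r w]. *)
Lemma is_diff_scale (k dk : V -> R) (f df : V -> W) x :
  is_diff x k dk -> is_diff x f df ->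
  is_diff x (fun y => k y *: f y) (fun v => k x *: df v + dk v *: f x).
Proof.
move=> dkx dfx.
have cs : continuous (fun p : R * W => p.1 *: p.2).
  by move=> p; apply: scale_continuous.
have dp : is_diff (k x, f x) (fun p : R * W => p.1 *: p.2)
    (fun q => k x *: q.2 + q.1 *: f x).
  by apply: DiffDef; [exact: differentiable_bilin | rewrite diff_bilin].
exact: (is_diff_comp (f := fun y => (k y, f y))).
Qed.
End ScaleDifferential.

(** * The operators on smooth functions *)

Section Smooth.
Context {R : realType} {W : normedModType R}.
Implicit Types (f g : pt R -> W) (i j : 'I_3).

Lemma smooth_differentiable {f} : smooth f -> forall x, differentiable f x.
Proof. by move=> sf; exact: (sf [::]). Qed.

Lemma smooth_iter_partial w f : smooth f -> smooth (iter_partial w f).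
Proof. by move=> sf w' x; rewrite /iter_partial -foldr_cat; exact: sf. Qed.

Lemma smooth_partial i f : smooth f -> smooth (partial i f).
Proof. exact: (smooth_iter_partial [:: i]). Qed.

Lemma partialD i f g : (forall x, differentiable f x) ->
  (forall x, differentiable g x) -> partial i (f + g) = partial i f + partial i g.
Proof. by move=> df dg; apply/funext => x; apply: deriveD; exact: diff_derivable. Qed.

Lemma partialZ i (a : R) f : (forall x, differentiable f x) ->
  partial i (a *: f) = a *: partial i f.
Proof. by move=> df; apply/funext => x; apply: deriveZ; exact: diff_derivable. Qed.

Lemma smoothD f g : smooth f -> smooth g -> smooth (f + g).
Proof.
move=> sf sg w; have -> : iter_partial w (f + g) = iter_partial w f + iter_partial w g.
  by elim: w => //= i w ->; rewrite partialD.
by move=> x; apply: differentiableD; [exact: sf | exact: sg].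
Qed.

Lemma smoothZ (a : R) f : smooth f -> smooth (a *: f).
Proof.
move=> sf w; have -> : iter_partial w (a *: f) = a *: iter_partial w f.
  by elim: w => //= i w ->; rewrite partialZ.
by move=> x; apply: differentiableZ; exact: sf.
Qed.

Lemma smooth0 : smooth (0 : pt R -> W).
Proof.
move=> w; have -> : iter_partial w 0 = 0 :> (pt R -> W).
  by elim: w => //= i w ->; apply/funext => x; exact: derive_cst.
by move=> x; exact: differentiable_cst.
Qed.

Definition mulc j f : pt R -> W := fun x => Defs.coord x j *: f x.

Lemma is_diff_coord j (x : pt R) :
  is_diff x (fun y => Defs.coord y j : R) (fun y => Defs.coord y j).
Proof.
have lin : linear (fun y : pt R => Defs.coord y j : R).
  by move=> a y z; rewrite /Defs.coord !mxE.
(* A continuous linear map is its own differential. *)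
pose L : {linear 'rV[R]_3 -> R^o} := HB.pack (fun y : pt R => Defs.coord y j : R^o)
  (GRing.isLinear.Build _ _ _ _ _ lin).
have cL : continuous L by move=> y; exact: coord_continuous.
apply: DiffDef; first exact: differentiable_coord.
exact: (diff_lin x cL).
Qed.

Lemma is_diff_mulc j f x : differentiable f x ->
  is_diff x (mulc j f) (fun v => Defs.coord x j *: 'd f x v + Defs.coord v j *: f x).
Proof.
by move=> df; apply: is_diff_scale; [exact: is_diff_coord | exact: differentiableP].
Qed.

Lemma differentiable_mulc j f x : differentiable f x -> differentiable (mulc j f) x.
Proof. by move/(is_diff_mulc j) => d; exact: ex_diff. Qed.

Lemma partial_mulc i j f : (forall x, differentiable f x) ->
  partial i (mulc j f) = (i == j)%:R *: f + mulc j (partial i f).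
Proof.
move=> df; apply/funext => x; have dm := is_diff_mulc j f x (df x).
rewrite /partial deriveE // diff_val /mulc addrC -deriveE //.
by rewrite /Defs.coord /evec mxE eqxx eq_sym.
Qed.

Lemma smooth_mulc j f : smooth f -> smooth (mulc j f).
Proof.
move=> sf w.
(* The class of functions [g + mulc j h] with [g], [h] smooth is stable under
   partial derivatives. *)
have [g [h [sg sh ->]]] : exists g h,
    [/\ smooth g, smooth h & iter_partial w (mulc j f) = g + mulc j h].
  elim: w => [|i w /= [g [h [sg sh ->]]]].
    by exists 0, f; split=> //; [exact: smooth0 | rewrite add0r].
  have dg := smooth_differentiable sg; have dh := smooth_differentiable sh.
  exists (partial i g + (i == j)%:R *: h), (partial i h); split.
  - by apply: smoothD; [exact: smooth_partial | exact: smoothZ].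
  - exact: smooth_partial.
  - rewrite partialD // => [|x]; last exact: differentiable_mulc.
    by rewrite partial_mulc // addrA.
move=> x; apply: differentiableD; first exact: smooth_differentiable.
exact/differentiable_mulc/smooth_differentiable.
Qed.

Lemma partial_comm i j f : smooth f ->
  partial i (partial j f) = partial j (partial i f).
Proof.
move=> sf; apply/funext => x; apply: derive_comm.
- exact: (sf [::]).
- exact: (sf [:: j]).
- exact: (sf [:: i]).
Qed.

Lemma differentiable_scale_mulc_partial f : smooth f ->
  forall (a : R) i j x, differentiable (a *: mulc j (partial i f)) x.
Proof.
move=> sf a i j x; apply/differentiableZ/differentiable_mulc.
exact: smooth_differentiable (smooth_partial i f sf) x.
Qed.

Lemma D1E f : D1 f = partial i0 f + (2^-1 : R) *: mulc i1 (partial i2 f).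
Proof. by apply/funext => x; rewrite /D1 mulrC -scalerA. Qed.

Lemma D2E f : D2 f = partial i1 f + (- 2^-1 : R) *: mulc i0 (partial i2 f).
Proof. by apply/funext => x; rewrite /D2 mulrC -scalerA -scaleNr. Qed.

Lemma smooth_D1 f : smooth f -> smooth (D1 f).
Proof.
move=> sf; rewrite D1E; apply: smoothD; first exact: smooth_partial.
exact/smoothZ/smooth_mulc/smooth_partial.
Qed.

Lemma smooth_D2 f : smooth f -> smooth (D2 f).
Proof.
move=> sf; rewrite D2E; apply: smoothD; first exact: smooth_partial.
exact/smoothZ/smooth_mulc/smooth_partial.
Qed.

(** Second-order terms cancel by symmetry of mixed partials. Differentiating the coefficients
    [x_2/2] and [-x_1/2] leaves one half of the third partial from each composition, with opposite
    signs. *)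
Lemma D2_D1 f : smooth f -> D2 (D1 f) = D1 (D2 f) + D3 f.
Proof.
move=> sf; have sp i := smooth_partial i f sf; have spp i j := smooth_partial i _ (sp j).
have d i := smooth_differentiable (sp i).
have dm i j x := differentiable_mulc j (partial i f) x (d i x).
have dZ := differentiable_scale_mulc_partial f sf.
rewrite (D2E (D1 f)) (D1E (D2 f)) D1E D2E.
rewrite !partialD // !partialZ // !partial_mulc //= /D3.
have pc i j := partial_comm i j f sf.
rewrite (pc i1 i0) (pc i2 i0) (pc i2 i1).
apply/funext => x.
(* At a fixed point only linear algebra in [W] remains: [a] and [b] are [x_1] and [x_2], [d'] is the
   third partial of [f], the capitals are second partials, and [h] is one half. *)
have H (h a b : R) (A B C E d' : W) : h + h = 1 ->
    A + h *: (1 *: d' + b *: B) + - h *: (a *: (C + h *: (0 *: d' + b *: E))) =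
    A + - h *: (1 *: d' + a *: C) + h *: (b *: (B + - h *: (0 *: d' + a *: E))) + d'.
  move=> hh; rewrite !(scale1r, scale0r, scaler0, add0r, scalerDr, scalerA).
  rewrite [RHS](AC (1*2*2*1) (1*((2*6)*4)*(3*5))) /=; congr (_ + (_ + _) + (_ + _ *: _)).
    by rewrite -{3}(scale1r d') -scalerDl -hh addrA addNr add0r.
  by ring.
apply: (H 2^-1 (Defs.coord x i0) (Defs.coord x i1)); by field.
Qed.

Lemma D1_D3 f : smooth f -> D3 (D1 f) = D1 (D3 f).
Proof.
move=> sf; have d i := smooth_differentiable (smooth_partial i f sf).
have dm i j x := differentiable_mulc j (partial i f) x (d i x).
have dZ := differentiable_scale_mulc_partial f sf.
rewrite !D1E /D3 partialD // partialZ // partial_mulc // scale0r add0r.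
by rewrite (partial_comm i2 i0).
Qed.

Lemma D2_D3 f : smooth f -> D3 (D2 f) = D2 (D3 f).
Proof.
move=> sf; have d i := smooth_differentiable (smooth_partial i f sf).
have dm i j x := differentiable_mulc j (partial i f) x (d i x).
have dZ := differentiable_scale_mulc_partial f sf.
rewrite !D2E /D3 partialD // partialZ // partial_mulc // scale0r add0r.
by rewrite (partial_comm i2 i1).
Qed.

Lemma mulcD j f g : mulc j (f + g) = mulc j f + mulc j g.
Proof. by apply/funext => x; exact: scalerDr. Qed.

Lemma mulcZ j (a : R) f : mulc j (a *: f) = a *: mulc j f.
Proof. by apply/funext => x; rewrite /mulc /= scalerA mulrC -scalerA. Qed.

Lemma smooth_Dop i f : smooth f -> smooth (Dop i f).
Proof.
rewrite /Dop; case: (_ == 0)%N; first exact: smooth_D1.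
by case: (_ == 1)%N; [exact: smooth_D2 | exact: smooth_partial].
Qed.

Lemma Dop_linear i (a : R) f g : smooth f -> smooth g ->
  Dop i (a *: f + g) = a *: Dop i f + Dop i g.
Proof.
move=> sf sg; have saf := smoothZ a f sf.
have pl j : partial j (a *: f + g) = a *: partial j f + partial j g.
  by rewrite partialD ?partialZ //; exact: smooth_differentiable.
rewrite /Dop; case: (_ == 0)%N; last case: (_ == 1)%N => //=.
- by rewrite !D1E !pl mulcD mulcZ !scalerDr !scalerA addrACA mulrC.
- by rewrite !D2E !pl mulcD mulcZ !scalerDr !scalerA addrACA mulrC.
- exact: pl.
Qed.
End Smooth.

(** * The module of smooth functions *)

Section SmoothFunctions.
Context {R : realType} {W : normedModType R}.

Definition smoothb : {pred pt R -> W} := fun f => `[< smooth f >].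

Lemma smoothb_submod : submod_closed smoothb.
Proof.
split; first exact/asboolP/smooth0.
move=> a f g /asboolP sf /asboolP sg.
by apply/asboolP; apply: smoothD => //; exact: smoothZ.
Qed.
HB.instance Definition _ :=
  GRing.isSubmodClosed.Build R (pt R -> W) smoothb smoothb_submod.

(** On arbitrary functions [derive] need not be additive; on this submodule the three operators are
    linear endomorphisms, as the abstract factorizations require. *)
Record smooth_fun := SmoothFun {
  smooth_val :> pt R -> W;
  smooth_valP : smooth_val \in smoothb }.
HB.instance Definition _ := [isSub for smooth_val].
HB.instance Definition _ := [Choice of smooth_fun by <:].
HB.instance Definition _ := [SubChoice_isSubLmodule of smooth_fun by <:].

Lemma smooth_funP (f : smooth_fun) : smooth f.
Proof. exact/asboolP/smooth_valP. Qed.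

Definition Dop_smooth i (f : smooth_fun) : smooth_fun :=
  SmoothFun (Dop i f) (asboolT (smooth_Dop i f (smooth_funP f))).

Lemma Dop_smooth_linear i : linear (Dop_smooth i).
Proof. by move=> a f g; apply/val_inj => /=; apply: Dop_linear; exact: smooth_funP. Qed.
HB.instance Definition _ i :=
  GRing.isLinear.Build R smooth_fun smooth_fun _ (Dop_smooth i) (Dop_smooth_linear i).

Lemma word_op_smooth w (f : smooth_fun) :
  word_op w f = foldr (fun i => Dop_smooth i) f w :> (pt R -> W).
Proof. by elim: w => //= i w ->. Qed.

Lemma smooth_valE n (c : 'I_n -> R) (F : 'I_n -> smooth_fun) x :
  (\sum_(m < n) c m *: F m : smooth_fun) x = \sum_(m < n) c m *: (F m : pt R -> W) x.
Proof.
rewrite -[smooth_val _]/(val _) raddf_sum fct_sumE.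
exact: eq_bigr.
Qed.

Lemma sym_smooth p q r (f : smooth_fun) :
  sym p q r f = sym_words (fun i => Dop_smooth i) f p q r :> (pt R -> W).
Proof.
apply/funext => x; rewrite /sym /sym_words; congr (_ *: _).
rewrite -[smooth_val _]/(val _) raddf_sum fct_sumE.
by apply: eq_bigr => w _; rewrite word_op_smooth.
Qed.

Lemma Dpm_smooth sign a b (f : smooth_fun) :
  Dpm sign a b f = Dpm_sum (sym_words (fun i => Dop_smooth i) f) sign a b :> (pt R -> W).
Proof.
apply/funext => x; rewrite /Dpm /Dpm_sum smooth_valE.
by apply: eq_bigr => m _; rewrite sym_smooth.
Qed.

Lemma Dc_smooth y a (f : smooth_fun) :
  Dc y a f = Dc_sum (sym_words (fun i => Dop_smooth i) f) y a :> (pt R -> W).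
Proof.
apply/funext => x; rewrite /Dc /Dc_sum smooth_valE.
by apply: eq_bigr => m _; rewrite sym_smooth.
Qed.

Lemma opow_smooth i n (f : smooth_fun) :
  opow (Dop i) n f = iter n (Dop_smooth i) f :> (pt R -> W).
Proof. by rewrite /opow; elim: n => //= n ->. Qed.

End SmoothFunctions.

(** * Transfer of the factorizations to differential operators *)

Section Factorization.
Context {R : realType} {W : normedModType R}.
Local Notation X := (Dop_smooth (R := R) (W := W) i0).
Local Notation Y := (Dop_smooth (R := R) (W := W) i1).
Local Notation Z := (Dop_smooth (R := R) (W := W) i2).

Let YX f : Y (X f) = X (Y f) + Z f.
Proof. by apply/val_inj/D2_D1/smooth_funP. Qed.

Let ZX f : Z (X f) = X (Z f).
Proof. by apply/val_inj/D1_D3/smooth_funP. Qed.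

Let ZY f : Z (Y f) = Y (Z f).
Proof. by apply/val_inj/D2_D3/smooth_funP. Qed.

Let s_rec f := sym_words_rec (fun i => Dop_smooth (R := R) (W := W) i) f.

Implicit Types (f : pt R -> W) (k l n : nat).

Lemma smooth_opow i n f : smooth f -> smooth (opow (Dop i) n f).
Proof. by move=> sf; elim: n => //= n IH; exact: smooth_Dop. Qed.

Lemma Dp_factor k l f : smooth f ->
  Dpm true k l f = opow (@D2 R W) l (opow (@D1 R W) k f).
Proof.
move=> sf; pose F := SmoothFun f (asboolT sf); rewrite -[f]/(F : pt R -> W).
rewrite -[@D1 R W]/(Dop i0) -[@D2 R W]/(Dop i1) opow_smooth opow_smooth Dpm_smooth.
by rewrite (Dp_sum_factor _ _ _ _ YX ZX ZY (s_rec F)) sym_words0.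
Qed.

Lemma Dm_factor k l f : smooth f ->
  Dpm false k l f = opow (@D1 R W) k (opow (@D2 R W) l f).
Proof.
move=> sf; pose F := SmoothFun f (asboolT sf); rewrite -[f]/(F : pt R -> W).
rewrite -[@D1 R W]/(Dop i0) -[@D2 R W]/(Dop i1) opow_smooth opow_smooth Dpm_smooth.
by rewrite (Dm_sum_factor _ _ _ _ YX ZX ZY (s_rec F)) sym_words0.
Qed.

Lemma Dc_factorX k l f : smooth f -> (k <= l)%N ->
  Dc ((2 * k)%:R - l%:R) l f = opow (@D1 R W) (l - k) (Dpm true k l f).
Proof.
move=> sf kl; pose F := SmoothFun f (asboolT sf); rewrite -[f]/(F : pt R -> W).
rewrite -[@D1 R W]/(Dop i0) Dpm_smooth opow_smooth Dc_smooth.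
by rewrite (Dc_sum_factorX _ _ _ _ YX ZX ZY (s_rec F)).
Qed.

Lemma Dc_factorY k l f : smooth f -> (l <= k)%N ->
  Dc (k%:R - (2 * l)%:R) k f = opow (@D2 R W) (k - l) (Dpm false k l f).
Proof.
move=> sf lk; pose F := SmoothFun f (asboolT sf); rewrite -[f]/(F : pt R -> W).
rewrite -[@D2 R W]/(Dop i1) Dpm_smooth opow_smooth Dc_smooth.
by rewrite (Dc_sum_factorY _ _ _ _ YX ZX ZY (s_rec F)).
Qed.

Lemma opow_D1_Dc k l f : smooth f -> (l <= k)%N ->
  opow (@D1 R W) (k - l) (Dc ((2 * k)%:R - l%:R) l f) = Dpm true k l f.
Proof.
move=> sf lk; pose F := SmoothFun f (asboolT sf); rewrite -[f]/(F : pt R -> W).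
rewrite -[@D1 R W]/(Dop i0) Dpm_smooth Dc_smooth opow_smooth.
by rewrite (iterX_Dc_sum _ _ _ _ YX ZX ZY (s_rec F)).
Qed.

Lemma opow_D2_Dc k l f : smooth f -> (k <= l)%N ->
  opow (@D2 R W) (l - k) (Dc (k%:R - (2 * l)%:R) k f) = Dpm false k l f.
Proof.
move=> sf kl; pose F := SmoothFun f (asboolT sf); rewrite -[f]/(F : pt R -> W).
rewrite -[@D2 R W]/(Dop i1) Dpm_smooth Dc_smooth opow_smooth.
by rewrite (iterY_Dc_sum _ _ _ _ YX ZX ZY (s_rec F)).
Qed.
End Factorization.

Theorem theorem8p8 (R : realType) (W : normedModType R) (k l : nat)
  (hk : (0 < k)%N) (hl : (0 < l)%N) :
  let D1 := @D1 R W in let D2 := @D2 R W in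
  let Dp := @Dpm R W true in let Dm := @Dpm R W false in
  let Dc := @Dc R W in
  (* (1) *)
  ((k < l)%N -> forall f : pt R -> W, smooth f ->
     [/\ Dp k l f = opow D2 l (opow D1 k f),
         Dm (l - k)%N l f = opow D1 (l - k) (opow D2 l f),
         Dc ((2 * k)%:R - l%:R) l f = opow D1 (l - k) (Dp k l f),
         opow D1 (l - k) (Dp k l f) = Dm (l - k)%N l (opow D1 k f)
       & Dm (l - k)%N l (opow D1 k f)
           = opow D1 (l - k) (opow D2 l (opow D1 k f))]) /\
  (* (2) *)
  ((l < k)%N -> forall f : pt R -> W, smooth f ->
     opow D1 (k - l) (Dc ((2 * k)%:R - l%:R) l f) = Dp k l f /\
     Dp k l f = opow D2 l (opow D1 k f)) /\
  (* (3) *)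
  ((l < k)%N -> forall f : pt R -> W, smooth f ->
     [/\ Dp k (k - l)%N f = opow D2 (k - l) (opow D1 k f),
         Dm k l f = opow D1 k (opow D2 l f),
         Dc (k%:R - (2 * l)%:R) k f = Dp k (k - l)%N (opow D2 l f),
         Dp k (k - l)%N (opow D2 l f) = opow D2 (k - l) (Dm k l f)
       & opow D2 (k - l) (Dm k l f)
           = opow D2 (k - l) (opow D1 k (opow D2 l f))]) /\
  (* (4) *)
  ((k < l)%N -> forall f : pt R -> W, smooth f ->
     opow D2 (l - k) (Dc (k%:R - (2 * l)%:R) k f) = Dm k l f /\
     Dm k l f = opow D1 k (opow D2 l f)) /\
  (* (5) *)
  (forall f : pt R -> W, smooth f ->
     Dc k%:R k f = Dp k k f /\ Dp k k f = opow D2 k (opow D1 k f)) /\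
  (* (6) *)
  (forall f : pt R -> W, smooth f ->
     Dc (- k%:R) k f = Dm k k f /\ Dm k k f = opow D1 k (opow D2 k f)).
Proof.
move=> D1 D2 Dp Dm Dc.
have sD1 n f : smooth f -> smooth (opow D1 n f) by exact: (smooth_opow i0).
have sD2 n f : smooth f -> smooth (opow D2 n f) by exact: (smooth_opow i1).
split=> [/ltnW kl f sf|]; first split.
- exact: Dp_factor.
- exact: Dm_factor.
- exact: Dc_factorX.
- by rewrite /Dp /Dm Dp_factor // Dm_factor //; exact: sD1.
- by rewrite /Dm Dm_factor //; exact: sD1.
split=> [/ltnW lk f sf|]; first by split; [exact: opow_D1_Dc | exact: Dp_factor].
split=> [/ltnW lk f sf|]; first split.
- exact: Dp_factor.
- exact: Dm_factor.
(* Both sides are brought to [D_2^(k-l) D_1^k D_2^l f]. *)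
- rewrite /Dp Dp_factor; last exact: sD2.
  by rewrite /Dc Dc_factorY // Dm_factor.
- by rewrite /Dp /Dm Dm_factor // Dp_factor //; exact: sD2.
- by rewrite /Dm Dm_factor.
split=> [/ltnW kl f sf|]; first by split; [exact: opow_D2_Dc | exact: Dm_factor].
(* Cases (5) and (6) are the factorizations of [D_c] at [l = k], where the outer power is trivial
   and the parameter [s] is [k] or [-k]. *)
have k2 : (2 * k)%:R - k%:R = k%:R :> R by rewrite natrM; ring.
split=> f sf; split; [|exact: Dp_factor| |exact: Dm_factor].
  by have := Dc_factorX k k f sf (leqnn k); rewrite k2 subnn.
by have := Dc_factorY k k f sf (leqnn k); rewrite -opprB k2 subnn.
Qed.
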